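(* Let $ABC$ be a (non-degenerate) triangle in the Euclidean plane and let $X$ be a point with normalized barycentric coordinates $(x_0,x_1,x_2)$ with respect to $ABC$ (that is, $X = x_0A+x_1B+x_2C$ with $x_0+x_1+x_2=1$) that satisfy $$(x_0+x_1)(x_1+x_2) > 0,\quad (x_0+x_2)(x_1+x_2) > 0,\quad (x_0+x_1)(x_0+x_2) > 0.$$ Then there exist precisely three exparabolas of $ABC$ whose axes are incident with $X$, and they are each opposite to one of the triangle vertices (one opposite to $A$, one opposite to $B$, one opposite to $C$).
   Context: An exparabola of a triangle $ABC$ is a (real, non-degenerate) parabola that is tangent to the three side lines $BC$, $CA$, $AB$ of the triangle. An exparabola is called opposite to $C$ if it is tangent to $AB$ in a point strictly between $A$ and $B$; opposite to $A$ and opposite to $B$ are defined analogously with the sides $BC$ and $CA$, respectively. The axis of a parabola is its line of symmetry. *)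

(* Defs.v *)
From mathcomp Require Import all_boot all_order all_algebra.
From mathcomp Require Import boolp classical_sets functions cardinality reals.

Set Implicit Arguments.
Unset Strict Implicit.
Unset Printing Implicit Defensive.

Import Order.TTheory GRing.Theory Num.Theory.

Local Open Scope classical_set_scope.
Local Open Scope ring_scope.

Section Plane.
Context {R : realType}.
Implicit Types (U V T X A B C p q : 'rV[R]_2).
Implicit Types (L P : set 'rV[R]_2) (M : 'M[R]_(2 + 1)).

Definition dot p q : R := (p *m q^T) 0 0.

Definition line U V : set 'rV[R]_2 := [set U + t *: (V - U) | t in [set: R]].

Definition open_segment U V : set 'rV[R]_2 :=
  [set U + t *: (V - U) | t in [set t : R | 0 < t < 1]].

Definition is_line L : Prop := exists U V, U <> V /\ L = line U V.

Definition nondegenerate_triangle A B C : Prop :=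
  ~ exists L, [/\ is_line L, L A, L B & L C].

(* Orthogonal reflection in the line U V; meaningful for U <> V only. *)
Definition reflection U V p : 'rV[R]_2 :=
  let foot := U + (dot (p - U) (V - U) / dot (V - U) (V - U)) *: (V - U) in
  2 *: foot - p.

Definition is_symmetry_line P L : Prop :=
  exists U V, [/\ U <> V, L = line U V & reflection U V @` P = P].

Definition homogeneous p : 'rV[R]_(2 + 1) := row_mx p 1%:M.

Definition conic_form M p q : R :=
  (homogeneous p *m M *m (homogeneous q)^T) 0 0.

Definition conic M : set 'rV[R]_2 := [set p | conic_form M p p = 0].

(* Symmetric matrices of regular conics that touch the line at infinity: the
   points at infinity (x : y : 0) of the conic are the zeros of the binary
   quadratic form M00 x^2 + 2 M01 x y + M11 y^2, which is nonzero because M is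
   regular, and which has a double zero iff its discriminant vanishes.
   Such a conic always has real points. *)
Definition parabola_matrix M : Prop :=
  [/\ M^T = M, \det M != 0 & M 0 0 * M 1 1 = M 0 1 ^+ 2].

(* Parabolas are identified with their point sets; the matrix is then
   determined up to a nonzero factor. *)
Definition is_parabola P : Prop := exists2 M, parabola_matrix M & P = conic M.

(* The tangent of a regular conic at one of its points T is the polar of T,
   i.e. the line through T orthogonal to the gradient of the equation. *)
Definition tangent_at P L T : Prop :=
  exists M, [/\ parabola_matrix M, P = conic M, P T
              & L = [set p | conic_form M T p = 0]].

Definition tangent P L : Prop := exists T, tangent_at P L T.

Definition exparabola A B C P : Prop :=
  [/\ is_parabola P, tangent P (line B C), tangent P (line C A)
    & tangent P (line A B)].

(* The side U V is the one facing the vertex: an exparabola of A B C is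
   opposite to C if it satisfies this predicate for the side A B. *)
Definition touches_side_inside U V P : Prop :=
  exists2 T, open_segment U V T & tangent_at P (line U V) T.

Definition opposite_A A B C P : Prop :=
  exparabola A B C P /\ touches_side_inside B C P.
Definition opposite_B A B C P : Prop :=
  exparabola A B C P /\ touches_side_inside C A P.
Definition opposite_C A B C P : Prop :=
  exparabola A B C P /\ touches_side_inside A B P.

Definition axis_through P X : Prop := exists2 L, is_symmetry_line P L & L X.

Definition exparabolas_with_axis_through A B C X : set (set 'rV[R]_2) :=
  [set P | exparabola A B C P /\ axis_through P X].

End Plane.

(* Main.v *)
Require Import Defs.
From mathcomp Require Import all_boot all_order all_algebra.
From mathcomp Require Import ring lra.
From mathcomp Require polyrcf.
From mathcomp Require Import boolp classical_sets functions cardinality reals.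

Set Implicit Arguments.
Unset Strict Implicit.
Unset Printing Implicit Defensive.

Import Order.TTheory GRing.Theory Num.Theory.

Local Open Scope classical_set_scope.
Local Open Scope card_scope.
Local Open Scope ring_scope.

(* In barycentric coordinates the exparabolas are the conics
   p^2 x^2 + q^2 y^2 + r^2 z^2 - 2 q r y z - 2 r p z x - 2 p q x y = 0 with
   p + q + r = 0 and p q r <> 0. Such a parabola touches the sides at
   (0 : r : q), (r : 0 : p) and (q : p : 0), so that exactly one contact point
   lies inside its side, and its axis has direction w = p A + q B + r C. The
   axis is the polar of the point at infinity orthogonal to w, hence passing
   through X is a binary cubic equation in (p : q : r). At the directions
   (0 : 1 : -1), (-1 : 0 : 1), (1 : -1 : 0) of the sides the cubic form takes
   the values |BC|^2 (x1 + x2), |CA|^2 (x0 + x2), |AB|^2 (x0 + x1), which are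
   positive; as the form is odd, it has a zero in each of the three arcs
   between consecutive side directions, and these are all its zeros. *)

(** * Bilinear forms in homogeneous coordinates *)

Section BilinearForms.
Context {R : realType}.
Implicit Types (U V T X A B C p q : 'rV[R]_2) (u v w : 'rV[R]_(2 + 1)).
Implicit Types (M N K : 'M[R]_(2 + 1)).

Lemma sum3 (f : 'I_(2 + 1) -> R) : \sum_i f i = f 0 + f 1 + f 2.
Proof.
rewrite (big_ord_recl 2) !big_ord_recl big_ord0 addr0 addrA.
by congr (_ + f _ + f _); apply: val_inj.
Qed.

Lemma ord3 (i : 'I_(2 + 1)) : [\/ i = 0, i = 1 | i = 2].
Proof.
case: i => [[|[|[|i]]] hi] //.
- by apply: Or31; apply: val_inj.
- by apply: Or32; apply: val_inj.
- by apply: Or33; apply: val_inj.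
Qed.

Lemma row2P p q : p 0 0 = q 0 0 -> p 0 1 = q 0 1 -> p = q.
Proof.
move=> e0 e1; apply/rowP => -[[|[|i]] hi] //.
- by rewrite (_ : Ordinal hi = 0) //; apply: val_inj.
- by rewrite (_ : Ordinal hi = 1) //; apply: val_inj.
Qed.

Lemma row3P u v : u 0 0 = v 0 0 -> u 0 1 = v 0 1 -> u 0 2 = v 0 2 -> u = v.
Proof. by move=> e0 e1 e2; apply/rowP => i; case: (ord3 i) => ->. Qed.

Definition bform M u v : R := (u *m M *m v^T) 0 0.

Lemma conic_formE M p q : conic_form M p q = bform M (homogeneous p) (homogeneous q).
Proof. by []. Qed.

Lemma bformE M u v : bform M u v =
  (u 0 0 * M 0 0 + u 0 1 * M 1 0 + u 0 2 * M 2 0) * v 0 0 +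
  (u 0 0 * M 0 1 + u 0 1 * M 1 1 + u 0 2 * M 2 1) * v 0 1 +
  (u 0 0 * M 0 2 + u 0 1 * M 1 2 + u 0 2 * M 2 2) * v 0 2.
Proof. by rewrite /bform !mxE sum3 !mxE !sum3. Qed.

Lemma bformDl M u v w : bform M (u + v) w = bform M u w + bform M v w.
Proof. by rewrite /bform !mulmxDl mxE. Qed.

Lemma bformDr M u v w : bform M w (u + v) = bform M w u + bform M w v.
Proof. by rewrite /bform linearD mulmxDr mxE. Qed.

Lemma bformZl M c u v : bform M (c *: u) v = c * bform M u v.
Proof. by rewrite /bform -!scalemxAl mxE. Qed.

Lemma bformZr M c u v : bform M u (c *: v) = c * bform M u v.
Proof. by rewrite /bform linearZ -scalemxAr mxE. Qed.

Lemma bformC M u v : M^T = M -> bform M u v = bform M v u.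
Proof.
move=> sM; rewrite /bform -[in LHS](trmxK (u *m M *m v^T)) mxE !trmx_mul trmxK sM mulmxA //.
Qed.

Lemma bform_scale c M u v : bform (c *: M) u v = c * bform M u v.
Proof. by rewrite /bform -scalemxAr -scalemxAl mxE. Qed.

(** Directions of the plane as points at infinity; differences of normalized points have this
    form. *)
Definition ideal p : 'rV[R]_(2 + 1) := row_mx p 0.

Lemma hom0 p : homogeneous p 0 0 = p 0 0.
Proof. by rewrite /homogeneous -(@row_mxEl _ 1 2 1 p 1%:M 0 0); congr (row_mx _ _ _ _); apply: val_inj. Qed.
Lemma hom1 p : homogeneous p 0 1 = p 0 1.
Proof. by rewrite /homogeneous -(@row_mxEl _ 1 2 1 p 1%:M 0 1); congr (row_mx _ _ _ _); apply: val_inj. Qed.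
Lemma hom2 p : homogeneous p 0 2 = 1.
Proof. have e : (2 : 'I_(2 + 1)) = rshift 2 0 by apply: val_inj.
by rewrite /homogeneous e row_mxEr mxE. Qed.
Lemma ideal0 p : ideal p 0 0 = p 0 0.
Proof. by rewrite /ideal -(@row_mxEl _ 1 2 1 p 0 0 0); congr (row_mx _ _ _ _); apply: val_inj. Qed.
Lemma ideal1 p : ideal p 0 1 = p 0 1.
Proof. by rewrite /ideal -(@row_mxEl _ 1 2 1 p 0 0 1); congr (row_mx _ _ _ _); apply: val_inj. Qed.
Lemma ideal2 p : ideal p 0 2 = 0.
Proof. have e : (2 : 'I_(2 + 1)) = rshift 2 0 by apply: val_inj.
by rewrite /ideal e row_mxEr mxE. Qed.
Definition coordE := (hom0, hom1, hom2, ideal0, ideal1, ideal2).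

Lemma dotE p q : dot p q = p 0 0 * q 0 0 + p 0 1 * q 0 1.
Proof.
rewrite /dot !mxE !big_ord_recl big_ord0 !mxE addr0.
by congr (p _ _ * q _ _ + p _ _ * q _ _); apply: val_inj.
Qed.

Lemma det3E K : \det K =
  K 0 0 * (K 1 1 * K 2 2 - K 1 2 * K 2 1)
  - K 0 1 * (K 1 0 * K 2 2 - K 1 2 * K 2 0)
  + K 0 2 * (K 1 0 * K 2 1 - K 1 1 * K 2 0).
Proof.
rewrite (expand_det_row _ 0) sum3 /cofactor !(expand_det_row _ 0).
rewrite !big_ord_recl !big_ord0 /cofactor !det_mx11 !mxE.
(* Cofactor expansion leaves lifted ordinals as indices. Reading the entries through natural numbers
   makes these indices compute to numerals. *)
pose k (m n : nat) : R := K (inord m) (inord n).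
have e i j : K i j = k i j by rewrite /k !inord_val.
rewrite !e.
transitivity (k 0%N 0%N * ((-1) ^+ 0 * (k 1%N 1%N * ((-1) ^+ 0 * k 2%N 2%N) +
    (k 1%N 2%N * ((-1) ^+ 1 * k 2%N 1%N) + 0))) +
  k 0%N 1%N * ((-1) ^+ 1 * (k 1%N 0%N * ((-1) ^+ 0 * k 2%N 2%N) +
    (k 1%N 2%N * ((-1) ^+ 1 * k 2%N 0%N) + 0))) +
  k 0%N 2%N * ((-1) ^+ 2 * (k 1%N 0%N * ((-1) ^+ 0 * k 2%N 1%N) +
    (k 1%N 1%N * ((-1) ^+ 1 * k 2%N 0%N) + 0)))); first by [].
transitivity (k 0%N 0%N * (k 1%N 1%N * k 2%N 2%N - k 1%N 2%N * k 2%N 1%N)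
  - k 0%N 1%N * (k 1%N 0%N * k 2%N 2%N - k 1%N 2%N * k 2%N 0%N)
  + k 0%N 2%N * (k 1%N 0%N * k 2%N 1%N - k 1%N 1%N * k 2%N 0%N)); first by ring.
by [].
Qed.

End BilinearForms.

(** * Gram matrices in a frame, and the point of a parabola at infinity *)

Section Frames.
Context {R : realType}.
Implicit Types (U V T X A B C p q : 'rV[R]_2) (u v w : 'rV[R]_(2 + 1)).
Implicit Types (M N K : 'M[R]_(2 + 1)).

Lemma homD p q : homogeneous (p + q) = homogeneous p + ideal q.
Proof. by apply: row3P; rewrite !(coordE, mxE) ?addr0. Qed.

Lemma idealD p q : ideal (p + q) = ideal p + ideal q.
Proof. by apply: row3P; rewrite !(coordE, mxE) ?addr0. Qed.

Lemma idealZ (c : R) p : ideal (c *: p) = c *: ideal p.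
Proof. by apply: row3P; rewrite !(coordE, mxE) ?mulr0. Qed.

Definition frame u v w : 'M[R]_(2 + 1) :=
  \matrix_(i, j) nth 0 [:: u; v; w] i 0 j.

Lemma frameE u v w i j : frame u v w i j = nth 0 [:: u; v; w] i 0 j.
Proof. by rewrite mxE. Qed.

Lemma frame_bform M u v w i j :
  (frame u v w *m M *m (frame u v w)^T) i j =
  bform M (nth 0 [:: u; v; w] i) (nth 0 [:: u; v; w] j).
Proof. by rewrite !mxE sum3 !mxE !sum3 bformE !mxE. Qed.

Lemma mul_frame x u v w : x *m frame u v w = x 0 0 *: u + x 0 1 *: v + x 0 2 *: w.
Proof. by apply/rowP => j; rewrite !mxE sum3 !mxE. Qed.

(** By symmetry the six values fill the whole Gram matrix of [N] in an invertible frame. *)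
Lemma bform_frame_eq0 N u v w : \det (frame u v w) != 0 -> N^T = N ->
  bform N u u = 0 -> bform N u v = 0 -> bform N u w = 0 ->
  bform N v v = 0 -> bform N v w = 0 -> bform N w w = 0 -> N = 0.
Proof.
move=> dF sN uu uv uw vv vw ww.
have Fu : frame u v w \in unitmx by rewrite unitmxE unitfE.
have G0 : frame u v w *m N *m (frame u v w)^T = 0.
  apply/matrixP => i j; rewrite frame_bform [RHS]mxE.
  by case: (ord3 i) => ->; case: (ord3 j) => -> //=; rewrite bformC.
have: invmx (frame u v w) *m (frame u v w *m N *m (frame u v w)^T)
      *m invmx (frame u v w)^T = 0 by rewrite G0 mulmx0 mul0mx.
by rewrite !mulmxA mulVmx // mul1mx mulmxK // unitmx_tr.
Qed.

Lemma bform_frame_nondeg M x u v w : \det M != 0 -> \det (frame u v w) != 0 ->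
  bform M x u = 0 -> bform M x v = 0 -> bform M x w = 0 -> x = 0.
Proof.
move=> dM dF hu hv hw.
have Fu : (frame u v w)^T \in unitmx by rewrite unitmx_tr unitmxE unitfE.
have Mu : M \in unitmx by rewrite unitmxE unitfE.
have e : x *m M *m (frame u v w)^T = 0.
  apply/rowP => j; rewrite [RHS]mxE.
  transitivity (bform M x (nth 0 [:: u; v; w] j)).
    by rewrite bformE !mxE sum3 !mxE !sum3.
  by case: (ord3 j) => ->.
rewrite -[x](mulmxK Mu) -[x *m M](mulmxK Fu) e.
by rewrite mul0mx mul0mx.
Qed.

Definition perp p : 'rV[R]_2 := \row_j (if j == 0 then - p 0 1 else p 0 0).

Lemma perp0 p : perp p 0 0 = - p 0 1. Proof. by rewrite mxE. Qed.
Lemma perp1 p : perp p 0 1 = p 0 0. Proof. by rewrite mxE. Qed.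

Lemma sqr_coord_gt0 p : p != 0 -> 0 < p 0 0 ^+ 2 + p 0 1 ^+ 2.
Proof.
move=> p0; rewrite lt_neqAle addr_ge0 ?sqr_ge0 // andbT eq_sym paddr_eq0 ?sqr_ge0 //.
rewrite !sqrf_eq0; apply: contra p0 => /andP[/eqP e0 /eqP e1].
by apply/eqP/row2P; rewrite mxE.
Qed.

Lemma det_frameE u v w : \det (frame u v w) =
  u 0 0 * (v 0 1 * w 0 2 - v 0 2 * w 0 1)
  - u 0 1 * (v 0 0 * w 0 2 - v 0 2 * w 0 0)
  + u 0 2 * (v 0 0 * w 0 1 - v 0 1 * w 0 0).
Proof. by rewrite det3E !mxE. Qed.

(** The determinant is the squared length of [p]. *)
Lemma det_perp_frame U p : p != 0 ->
  \det (frame (homogeneous U) (ideal p) (ideal (perp p))) != 0.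
Proof.
move=> /sqr_coord_gt0; rewrite det_frameE !coordE perp0 perp1 => h.
by apply: lt0r_neq0; nra.
Qed.

Lemma perp_decomp p q : p != 0 -> exists a b, q = a *: p + b *: perp p.
Proof.
move=> /sqr_coord_gt0 /lt0r_neq0 h.
exists ((q 0 0 * p 0 0 + q 0 1 * p 0 1) / (p 0 0 ^+ 2 + p 0 1 ^+ 2)).
exists ((q 0 1 * p 0 0 - q 0 0 * p 0 1) / (p 0 0 ^+ 2 + p 0 1 ^+ 2)).
by apply: row2P; rewrite !(perp0, perp1, mxE) /=; field.
Qed.

(** If the determinant vanished, a kernel vector [v] would give an equation [v0 x + v1 y + v2 = 0]
    satisfied by all three vertices. Its normal [n] is nonzero, so this is the equation of a
    line. *)
Lemma nondegenerate_triangleP A B C : nondegenerate_triangle A B C ->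
  \det (frame (homogeneous A) (homogeneous B) (homogeneous C)) != 0.
Proof.
move=> ndeg; apply/negP; rewrite -det_tr => /det0P[v v0 e]; apply: ndeg.
have ev (i : 'I_(2 + 1)) (u := nth 0 [:: homogeneous A; homogeneous B; homogeneous C] i) :
    v 0 0 * u 0 0 + v 0 1 * u 0 1 + v 0 2 * u 0 2 = 0.
  by move/rowP: e => /(_ i); rewrite mxE sum3 ![_^T _ _]mxE !frameE mxE.
have := ev 2; have := ev 1; have := ev 0; rewrite /= !coordE => eA eB eC.
pose n : 'rV[R]_2 := \row_j (if j == 0 then v 0 0 else v 0 1).
have n0 : n 0 0 = v 0 0 by rewrite mxE.
have n1 : n 0 1 = v 0 1 by rewrite mxE.
have nn0 : n != 0.
  apply: contra v0 => /eqP /rowP n0'.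
  have v00 : v 0 0 = 0 by rewrite -n0 n0' mxE.
  have v01 : v 0 1 = 0 by rewrite -n1 n0' mxE.
  apply/eqP/row3P; rewrite ?v00 ?v01 mxE //.
  by move: eA; rewrite v00 v01 !mul0r !add0r mulr1.
have on_line p : v 0 0 * p 0 0 + v 0 1 * p 0 1 + v 0 2 * 1 = 0 -> line A (A + perp n) p.
  move=> ep; have [a [b e']] := perp_decomp (p - A) nn0.
  exists b => //; rewrite [A + perp n]addrC addrK.
  (* [a] is the coordinate of [p - A] along the normal; it vanishes because [p] and [A] satisfy the
     same equation. *)
  have a0 : a = 0.
    apply: (mulIf (lt0r_neq0 (sqr_coord_gt0 nn0))).
    move/rowP: e' => e'; have := e' 0; have := e' 1.
    rewrite !(perp0, perp1, n0, n1, mxE) => e1' e0'.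
    transitivity ((a * v 0 0 + b * - v 0 1) * v 0 0 + (a * v 0 1 + b * v 0 0) * v 0 1); first by ring.
    rewrite -e0' -e1'; transitivity
     ((v 0 0 * p 0 0 + v 0 1 * p 0 1 + v 0 2 * 1) - (v 0 0 * A 0 0 + v 0 1 * A 0 1 + v 0 2 * 1)); first by ring.
    by rewrite ep eA; ring.
  by rewrite a0 scale0r add0r in e'; rewrite -e' addrC subrK.
exists (line A (A + perp n)); split; try by apply: on_line.
exists A, (A + perp n); split => // e'.
have : perp n = 0 by apply: (@addrI _ A); rewrite -e' addr0.
move/rowP => p0; move/eqP: nn0; apply; apply: row2P.
- by have := p0 1; rewrite perp1 !mxE.
- by have := p0 0; rewrite perp0 !mxE => /eqP; rewrite oppr_eq0 => /eqP.
Qed.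

(** The binary form at infinity is degenerate, so its isotropic vectors lie in its kernel: the
    square of each component of the image of [p] is a multiple of the form at [p] plus a multiple of
    the discriminant. *)
Lemma isotropic_ker M p : parabola_matrix M ->
  bform M (ideal p) (ideal p) = 0 -> forall u, u 0 2 = 0 -> bform M (ideal p) u = 0.
Proof.
case=> sM _ disc; rewrite bformE !coordE => h u u2.
have m10 : M 1 0 = M 0 1 by rewrite -{1}sM mxE.
rewrite bformE !coordE u2 m10; rewrite m10 in h.
have e0 : M 0 0 * p 0 0 + M 0 1 * p 0 1 = 0.
  apply/eqP; rewrite -sqrf_eq0; apply/eqP.
  transitivity (M 0 0 * ((p 0 0 * M 0 0 + p 0 1 * M 0 1) * p 0 0 + (p 0 0 * M 0 1 + p 0 1 * M 1 1) * p 0 1)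
     + (M 0 1 ^+ 2 - M 0 0 * M 1 1) * p 0 1 ^+2); first by ring.
  rewrite disc; move: h; rewrite !mul0r !addr0 mulr0 addr0 => ->; ring.
have e1 : M 0 1 * p 0 0 + M 1 1 * p 0 1 = 0.
  apply/eqP; rewrite -sqrf_eq0; apply/eqP.
  transitivity (M 1 1 * ((p 0 0 * M 0 0 + p 0 1 * M 0 1) * p 0 0 + (p 0 0 * M 0 1 + p 0 1 * M 1 1) * p 0 1)
     + (M 0 1 ^+ 2 - M 0 0 * M 1 1) * p 0 0 ^+2); first by ring.
  rewrite disc; move: h; rewrite !mul0r !addr0 mulr0 addr0 => ->; ring.
transitivity ((M 0 0 * p 0 0 + M 0 1 * p 0 1) * u 0 0 + (M 0 1 * p 0 0 + M 1 1 * p 0 1) * u 0 1); first by ring.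
rewrite e0 e1; ring.
Qed.

(** The vector found is the double point at infinity of the conic, that is, the direction of its
    axis. *)
Lemma parabola_isotropic M : parabola_matrix M ->
  exists2 p, p != 0 & bform M (ideal p) (ideal p) = 0.
Proof.
case=> sM _ disc; have m10 : M 1 0 = M 0 1 by rewrite -{1}sM mxE.
have [m0|m0] := eqVneq (M 0 0) 0.
  exists (\row_j (if j == 0 then 1 else 0)).
    by apply/eqP => /rowP /(_ 0) /eqP; rewrite !mxE /= oner_eq0.
  by rewrite bformE !coordE !mxE /= m0; ring.
exists (\row_j (if j == 0 then - M 0 1 else M 0 0)).
  by apply/eqP => /rowP /(_ 1) /eqP; rewrite !mxE /= (negbTE m0).
rewrite bformE !coordE !mxE /= m10.
transitivity (M 0 0 * (M 0 0 * M 1 1 - M 0 1 ^+ 2)); first by ring.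
by rewrite disc; ring.
Qed.

(** In the frame of [X], [p] and [perp p] the Gram determinant collapses to [- b ^+ 2 * q], with [b]
    and [q] the two values in question. *)
Lemma isotropic_neq0 M X p : parabola_matrix M -> p != 0 ->
  bform M (ideal p) (ideal p) = 0 ->
  bform M (homogeneous X) (ideal p) != 0 /\
  bform M (ideal (perp p)) (ideal (perp p)) != 0.
Proof.
move=> PM p0 pp; have [sM dM _] := PM.
set F := frame (homogeneous X) (ideal p) (ideal (perp p)).
have dF : \det F != 0 by apply: det_perp_frame.
have : \det (F *m M *m F^T) != 0 by rewrite !det_mulmx det_tr !mulf_neq0.
rewrite det3E !frame_bform /= pp (isotropic_ker PM pp) ?coordE //.
rewrite (bformC (ideal (perp p)) (ideal p)) // (isotropic_ker PM pp) ?coordE //.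
rewrite (bformC (ideal p) (homogeneous X)) //.
set b := bform M _ (ideal p); set q := bform M (ideal (perp p)) _.
move=> h; split; apply: contra h => /eqP ->; apply/eqP; ring.
Qed.

End Frames.

(** * Point sets determine their matrices; tangency as a polarity condition *)

Section Tangents.
Context {R : realType}.
Implicit Types (U V T X A B C p q : 'rV[R]_2) (u v w : 'rV[R]_(2 + 1)).
Implicit Types (M N K : 'M[R]_(2 + 1)).

Lemma quartic_eq0 (a b c d e : R) :
  (forall t, a + b * t + c * t ^+ 2 + d * t ^+ 3 + e * t ^+ 4 = 0) ->
  [/\ a = 0, b = 0, c = 0, d = 0 & e = 0].
Proof.
move=> h.
have := h 0; have := h 1; have := h (-1); have := h 2; have := h (-2).
rewrite !exprS !expr0 => *; split; lra.
Qed.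

Lemma bform_subZ c M N u v : bform (N - c *: M) u v = bform N u v - c * bform M u v.
Proof. by rewrite !bformE !mxE; ring. Qed.

Lemma hom_neq0 p : homogeneous p != 0.
Proof. by apply/eqP => /rowP /(_ 2); rewrite hom2 mxE; apply/eqP/oner_neq0. Qed.

(* The points [p0 + t n + g t^2 w], with [p0] the vertex and [w] the direction
   of the axis, run through the parabola [conic M]. *)
Lemma conic_sub_proportional M N : parabola_matrix M -> N^T = N ->
  conic M `<=` conic N -> exists c, N = c *: M.
Proof.
move=> PM sN MN; have [sM dM _] := PM.
have [w w0 ww] := parabola_isotropic PM.
have wk := isotropic_ker PM ww.
set n := perp w.
have [_ q0] := isotropic_neq0 0 PM w0 ww; rewrite -/n in q0.
set q := bform M _ _ in q0.
(* The vertex is reached in two moves: along [n] to a point conjugate to [n], hence on the axis, and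
   then along [w] to the conic. *)
pose o1 := (- (bform M (homogeneous 0) (ideal n) / q)) *: n.
have [b1 _] := isotropic_neq0 o1 PM w0 ww.
pose p0 := o1 + (- (bform M (homogeneous o1) (homogeneous o1) /
                    (2 * bform M (homogeneous o1) (ideal w)))) *: w.
have [b0 _] := isotropic_neq0 p0 PM w0 ww.
set b := bform M _ _ in b0.
have nw : bform M (ideal n) (ideal w) = 0 by rewrite bformC // wk ?ideal2.
have p0n : bform M (homogeneous p0) (ideal n) = 0.
  rewrite /p0 homD idealZ bformDl bformZl (wk (ideal n)) ?ideal2 // mulr0 addr0.
  have -> : homogeneous o1 = homogeneous 0 + ideal o1 by rewrite -homD add0r.
  by rewrite /o1 idealZ bformDl bformZl -/q; field.
have p0p0 : bform M (homogeneous p0) (homogeneous p0) = 0.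
  rewrite /p0 homD idealZ !(bformDl, bformDr, bformZl, bformZr) ww.
  by rewrite (bformC (ideal w) (homogeneous o1)) //; field.
(* On the curve the form of [M] takes the value [(q + 2 b g) t^2], which this [g] cancels. *)
pose g := - (q / (2 * b)).
have g0 : g != 0 by rewrite oppr_eq0 mulf_neq0 ?invr_eq0 ?mulf_neq0 ?pnatr_eq0.
(* This [c] makes [N - c *: M] vanish at [(n, n)], so that the coefficient of [t ^+ 2] below
   isolates the value at [(p0, w)]. *)
pose c := bform N (ideal n) (ideal n) / q; exists c.
have sL : (N - c *: M)^T = N - c *: M by rewrite linearB linearZ /= sM sN.
have nn : bform (N - c *: M) (ideal n) (ideal n) = 0.
  by rewrite bform_subZ /c -/q; field.
have on_conic t : bform (N - c *: M) (homogeneous (p0 + (t *: n + (g * t ^+ 2) *: w)))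
     (homogeneous (p0 + (t *: n + (g * t ^+ 2) *: w))) = 0.
  set pt := p0 + _.
  have Mp : conic M pt.
    rewrite /conic /= conic_formE /pt homD idealD !idealZ.
    rewrite !(bformDl, bformDr, bformZl, bformZr) p0p0 ww nw.
    rewrite (bformC (ideal n) (homogeneous p0)) // p0n.
    rewrite (wk (ideal n)) ?ideal2 // (bformC (ideal w) (homogeneous p0)) // -/b -/q.
    by rewrite /g; field.
  have := MN _ Mp; rewrite /conic /= conic_formE => Np.
  by move: Mp; rewrite /conic /= conic_formE bform_subZ Np => ->; ring.
apply/eqP; rewrite -subr_eq0; apply/eqP.
have [] := @quartic_eq0 (bform (N - c *: M) (homogeneous p0) (homogeneous p0))
   (2 * bform (N - c *: M) (homogeneous p0) (ideal n))
   (2 * g * bform (N - c *: M) (homogeneous p0) (ideal w))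
   (2 * g * bform (N - c *: M) (ideal w) (ideal n))
   (g ^+ 2 * bform (N - c *: M) (ideal w) (ideal w)).
  move=> t; have := on_conic t; rewrite homD idealD !idealZ.
  rewrite !(bformDl, bformDr, bformZl, bformZr) nn.
  rewrite (bformC (ideal n) (homogeneous p0)) // (bformC (ideal w) (homogeneous p0)) //.
  by rewrite (bformC (ideal n) (ideal w)) // => e; rewrite -[RHS]e; ring.
have cancel (x y : R) : x != 0 -> x * y = 0 -> y = 0.
  by move=> x0 /eqP; rewrite mulf_eq0 (negbTE x0) /= => /eqP.
move=> h0 h1 h2 h3 h4.
apply: (bform_frame_eq0 (det_perp_frame p0 w0)) => //.
- by apply: cancel h2; rewrite mulf_neq0 ?pnatr_eq0.
- by apply: cancel h1; rewrite pnatr_eq0.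
- by apply: cancel h4; rewrite expf_neq0.
- by apply: cancel h3; rewrite mulf_neq0 ?pnatr_eq0.
Qed.

Lemma reflection_decomp U V a b : U <> V ->
  reflection U V (U + a *: (V - U) + b *: perp (V - U)) =
  U + a *: (V - U) - b *: perp (V - U).
Proof.
move=> UV.
have: V - U != 0 by rewrite subr_eq0; apply/eqP => e; apply: UV.
move=> /sqr_coord_gt0 /lt0r_neq0; rewrite !mxE => h.
by apply: row2P; rewrite /reflection !dotE !(perp0, perp1, mxE) /=; field;
  move: h; rewrite !expr2 //.
Qed.

Lemma decomp_at U V p : U <> V ->
  exists a b, p = U + a *: (V - U) + b *: perp (V - U).
Proof.
move=> UV; have VU : V - U != 0 by rewrite subr_eq0; apply/eqP => e; apply: UV.
have [a [b e]] := perp_decomp (p - U) VU.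
by exists a, b; rewrite -addrA -e addrC subrK.
Qed.

Lemma reflectionK U V p : U <> V -> reflection U V (reflection U V p) = p.
Proof.
move=> UV; have [a [b ->]] := decomp_at p UV.
by rewrite reflection_decomp // -scaleNr reflection_decomp // scaleNr opprK.
Qed.

Lemma conic_scale c M : c != 0 -> conic (c *: M) = conic M.
Proof.
move=> c0; apply/seteqP; split => p; rewrite /conic /= !conic_formE bform_scale.
  by move/eqP; rewrite mulf_eq0 (negbTE c0) /= => /eqP.
by move=> ->; rewrite mulr0.
Qed.

(** Tangency to a point set is witnessed by some matrix of it; this allows the witness to be
    exchanged for a given one. *)
Lemma conic_eq_proportional M N : parabola_matrix M -> parabola_matrix N ->
  conic M = conic N -> exists2 c, c != 0 & N = c *: M.
Proof.
move=> PM [sN dN _] e.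
have [|c Nc] := conic_sub_proportional PM sN; first by rewrite e.
exists c => //; apply: contra dN => /eqP c0.
by rewrite Nc c0 scale0r det0.
Qed.

Lemma idealB U V : ideal (V - U) = homogeneous V - homogeneous U.
Proof. by apply: (@addrI _ (homogeneous U)); rewrite -homD addrC subrK addrC subrK. Qed.

(** The polar of [T] is a line because [M] is regular, so it equals [line U V] once it contains [U]
    and [V]. As [T] lies on that line, it is conjugate to itself and hence on the conic. *)
Lemma tangent_atP M U V T : parabola_matrix M -> U <> V ->
  tangent_at (conic M) (line U V) T <->
  [/\ line U V T, bform M (homogeneous T) (homogeneous U) = 0
    & bform M (homogeneous T) (homogeneous V) = 0].
Proof.
move=> PM UV; have [sM dM _] := PM; split.
  case=> N [PN e NT eL].
  have [c c0 Nc] := conic_eq_proportional PM PN e.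
  have onL p : line U V p -> bform M (homogeneous T) (homogeneous p) = 0.
    rewrite eL /= conic_formE Nc bform_scale => /eqP.
    by rewrite mulf_eq0 (negbTE c0) /= => /eqP.
  split.
  - by rewrite eL /=; move: NT; rewrite e.
  - by apply: onL; exists 0 => //; rewrite scale0r addr0.
  - by apply: onL; exists 1 => //; rewrite scale1r addrC subrK.
case=> [[t _ tT] TU TV]; exists M; split => //.
  rewrite /conic /= conic_formE -{2}tT homD idealZ bformDr bformZr TU idealB.
  by rewrite bformDr -scaleN1r bformZr TU TV; ring.
have VU : V - U != 0 by rewrite subr_eq0; apply/eqP => e; apply: UV.
have TVU : bform M (homogeneous T) (ideal (V - U)) = 0.
  by rewrite idealB bformDr -scaleN1r bformZr TU TV; ring.
apply/seteqP; split => p /=; rewrite conic_formE.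
  by case=> s _ <-; rewrite homD idealZ bformDr bformZr TU TVU; ring.
have [a [b ->]] := decomp_at p UV.
rewrite !homD !idealZ !bformDr !bformZr TU TVU mulr0 !add0r => /eqP.
rewrite mulf_eq0 => /orP[/eqP -> | /eqP n0].
  by exists a => //; rewrite scale0r addr0.
(* In this case [T] is conjugate to a whole frame, against the regularity of [M]. *)
have := bform_frame_nondeg dM (det_perp_frame U VU) TU TVU n0.
by move/eqP; rewrite (negbTE (hom_neq0 T)).
Qed.

End Tangents.

(** * The axis as the polar of the point at infinity orthogonal to its direction *)

Section Axes.
Context {R : realType}.
Implicit Types (U V T X A B C p q : 'rV[R]_2) (u v w : 'rV[R]_(2 + 1)).
Implicit Types (M N K : 'M[R]_(2 + 1)).

(** A reflection is affine, hence linear in homogeneous coordinates: [S] is diagonal with entries 1,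
    1, -1 in the frame of [U], [V - U] and its normal. *)
Lemma reflection_matrix U V : U <> V ->
  exists S : 'M[R]_(2 + 1),
  [/\ forall p, homogeneous (reflection U V p) = homogeneous p *m S,
      homogeneous U *m S = homogeneous U,
      ideal (V - U) *m S = ideal (V - U)
    & ideal (perp (V - U)) *m S = - ideal (perp (V - U))].
Proof.
move=> UV.
have VU : V - U != 0 by rewrite subr_eq0; apply/eqP => e; apply: UV.
have Fu : frame (homogeneous U) (ideal (V - U)) (ideal (perp (V - U))) \in unitmx.
  by rewrite unitmxE unitfE det_perp_frame.
set u := V - U in VU Fu *; set F := frame _ _ _ in Fu.
exists (invmx F *m frame (homogeneous U) (ideal u) (- ideal (perp u))).
have S_coord (a b c : R) : (a *: homogeneous U + b *: ideal u + c *: ideal (perp u)) *m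
    (invmx F *m frame (homogeneous U) (ideal u) (- ideal (perp u))) =
    a *: homogeneous U + b *: ideal u - c *: ideal (perp u).
  pose x : 'rV[R]_(2 + 1) := \row_j nth 0 [:: a; b; c] j.
  have -> : a *: homogeneous U + b *: ideal u + c *: ideal (perp u) = x *m F.
    by rewrite mul_frame ![x _ _]mxE.
  by rewrite mulmxA mulmxK // mul_frame ![x _ _]mxE /= scalerN.
split.
- move=> p; have [a [b ->]] := decomp_at p UV.
  rewrite reflection_decomp // -scaleNr !homD !idealZ -/u.
  by have := S_coord 1 a b; rewrite scale1r => ->; rewrite scaleNr.
- by have := S_coord 1 0 0; rewrite !scale0r scale1r subr0 !addr0.
- by have := S_coord 0 1 0; rewrite !scale0r scale1r subr0 addr0 add0r.
- by have := S_coord 0 0 1; rewrite !scale0r scale1r addr0 !add0r.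
Qed.

Lemma bformNl M u v : bform M (- u) v = - bform M u v.
Proof. by rewrite -scaleN1r bformZl mulN1r. Qed.

Lemma bformNr M u v : bform M u (- v) = - bform M u v.
Proof. by rewrite -scaleN1r bformZr mulN1r. Qed.

Lemma perpZ (c : R) p : perp (c *: p) = c *: perp p.
Proof. by apply: row2P; rewrite !(perp0, perp1, mxE) ?mulrN. Qed.

Lemma eqN_eq0 (x : R) : x = - x -> x = 0.
Proof. by move=> h; lra. Qed.

Lemma axis_throughP M X (w : 'rV[R]_2) : parabola_matrix M -> w != 0 ->
  bform M (ideal w) (ideal w) = 0 ->
  axis_through (conic M) X <-> bform M (homogeneous X) (ideal (perp w)) = 0.
Proof.
move=> PM w0 ww; have [sM dM _] := PM; have wk := isotropic_ker PM ww.
split; last first.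
  move=> Xn; exists (line X (X + w)); last by exists 0; rewrite // scale0r addr0.
  have Xw : X <> X + w.
    by move=> e; move/eqP: w0; apply; apply: (@addrI _ X); rewrite addr0.
  exists X, (X + w); split => //.
  (* All mixed terms with [perp w] vanish, so the equation is even in the coordinate that the
     reflection negates. *)
  have refl p : conic M p -> conic M (reflection X (X + w) p).
    have [a [b ->]] := decomp_at p Xw; rewrite reflection_decomp //.
    rewrite [X + w]addrC addrK -scaleNr /conic /= !conic_formE !homD !idealZ.
    rewrite !(bformDl, bformDr, bformZl, bformZr) Xn ww (wk (ideal (perp w))) ?ideal2 //.
    rewrite (bformC (ideal (perp w)) (homogeneous X)) // Xn.
    rewrite (bformC (ideal (perp w)) (ideal w)) // (wk (ideal (perp w))) ?ideal2 //.
    by move=> e; rewrite -[RHS]e; ring.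
  apply/seteqP; split => p.
    by case=> q /refl h <-.
  move=> /refl h; exists (reflection X (X + w) p) => //.
  by rewrite reflectionK.
case=> _ [U [V [UV -> sym]]] [t _ tX].
have VU : V - U != 0 by rewrite subr_eq0; apply/eqP => e; apply: UV.
have [S [Sp SU Su Sn]] := reflection_matrix UV.
set u := V - U in VU Su Sn tX; set n := perp u in Sn.
(* By symmetry [S *m M *m S^T] vanishes on the conic, so it is a multiple of [M]. Both cases below
   force the factor to be 1, whence [S] preserves the form. *)
have [||c Nc] := @conic_sub_proportional _ M (S *m M *m S^T) PM.
- by rewrite !trmx_mul trmxK sM mulmxA.
- move=> p Mp; have : conic M (reflection U V p) by rewrite -sym; exists p.
  by rewrite /conic /= !conic_formE Sp /bform trmx_mul !mulmxA.
have Sc x y : bform M (x *m S) (y *m S) = c * bform M x y.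
  by rewrite -bform_scale -Nc /bform trmx_mul !mulmxA.
have cUn := Sc (homogeneous U) (ideal n).
have cun := Sc (ideal u) (ideal n).
have cuu := Sc (ideal u) (ideal u).
have cnn := Sc (ideal n) (ideal n).
rewrite SU Sn bformNr in cUn; rewrite Su Sn bformNr in cun.
rewrite Su in cuu; rewrite Sn bformNr bformNl opprK in cnn.
have c1 (x : R) : x != 0 -> x = c * x -> c = 1.
  by move=> x0 h; apply: (mulIf x0); rewrite mul1r.
have [a [b ew]] := perp_decomp w VU; rewrite -/n in ew.
(* Either [u] is isotropic and therefore parallel to [w], which is the desired case, or the line of
   symmetry would be orthogonal to [w]. *)
have [uu|uu] := eqVneq (bform M (ideal u) (ideal u)) 0.
  have [_ nn] := isotropic_neq0 U PM VU uu.
  have c_1 := c1 _ nn cnn; rewrite c_1 mul1r in cUn.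
  have Un := eqN_eq0 (esym cUn).
  have un := isotropic_ker PM uu (ideal2 n).
  have b0 : b = 0.
    move: ww; rewrite ew idealD !idealZ !(bformDl, bformDr, bformZl, bformZr).
    rewrite uu (bformC (ideal n)) // un !mulr0 !add0r !mulrA => /eqP.
    by rewrite mulf_eq0 (negbTE nn) orbF mulf_eq0 orbb => /eqP.
  rewrite ew b0 scale0r addr0 perpZ idealZ bformZr -tX homD idealZ bformDl bformZl.
  by rewrite Un un; ring.
have c_1 := c1 _ uu cuu; rewrite c_1 mul1r in cUn; rewrite c_1 mul1r in cun.
have Un := eqN_eq0 (esym cUn); have un := eqN_eq0 (esym cun).
have a0 : a = 0.
  have := wk (ideal u) (ideal2 u).
  rewrite ew idealD !idealZ !(bformDl, bformZl) (bformC (ideal n)) // un mulr0 addr0.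
  by move/eqP; rewrite mulf_eq0 (negbTE uu) orbF => /eqP.
(* Here [w] is a multiple of [n], which is conjugate to [U]; but no finite point is conjugate to the
   direction of the axis. *)
have [Uw _] := isotropic_neq0 U PM w0 ww.
by move: Uw; rewrite ew a0 scale0r add0r idealZ bformZr Un mulr0 eqxx.
Qed.

End Axes.

(** * The one-parameter family of inscribed parabolas and their contact points *)

Section InscribedParabolas.
Context {R : realType}.
Implicit Types (U V T X A B C p q : 'rV[R]_2) (u v w : 'rV[R]_(2 + 1)).
Implicit Types (M N K : 'M[R]_(2 + 1)).

Lemma frame_decomp u v w x : \det (frame u v w) != 0 ->
  exists a b c, x = a *: u + b *: v + c *: w.
Proof.
move=> dF; have Fu : frame u v w \in unitmx by rewrite unitmxE unitfE.
pose y := x *m invmx (frame u v w); exists (y 0 0), (y 0 1), (y 0 2).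
by rewrite -mul_frame mulmxKV.
Qed.

(* In the notation of the header [(p, q, r) = (t, 1, - 1 - t)]; this chart
   suffices because [q <> 0] for an exparabola. *)
Definition weight (t : R) (i : 'I_(2 + 1)) : R := nth 0 [:: t; 1; - 1 - t] i.

Definition inscribed (t : R) : 'M[R]_(2 + 1) :=
  \matrix_(i, j) ((if i == j then 1 else - 1) * weight t i * weight t j).

(** A barycentric row [x] has homogeneous coordinates [x *m F], so this congruence carries
    [inscribed t] from barycentric to Cartesian coordinates. *)
Definition ex_matrix A B C (t : R) : 'M[R]_(2 + 1) :=
  let F := frame (homogeneous A) (homogeneous B) (homogeneous C) in
  invmx F *m inscribed t *m (invmx F)^T.

Definition ex_direction A B C (t : R) : 'rV[R]_2 := t *: A + B + (- 1 - t) *: C.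

Section Triangle.
Context (A B C : 'rV[R]_2).
Let F := frame (homogeneous A) (homogeneous B) (homogeneous C).
Context (dF : \det F != 0).

Let Fu : F \in unitmx.
Proof. by rewrite unitmxE unitfE. Qed.

Lemma ideal_direction t : ideal (ex_direction A B C t) =
  t *: homogeneous A + homogeneous B + (- 1 - t) *: homogeneous C.
Proof. by apply: row3P; rewrite !(coordE, mxE); ring. Qed.

Lemma ex_matrix_sym t : (ex_matrix A B C t)^T = ex_matrix A B C t.
Proof.
rewrite /ex_matrix !trmx_mul trmxK mulmxA; congr (_ *m _ *m _).
apply/matrixP => i j; rewrite !mxE eq_sym; ring.
Qed.

Lemma ex_matrix_gram t : F *m ex_matrix A B C t *m F^T = inscribed t.
Proof.
by rewrite /ex_matrix -/F !mulmxA mulmxV // mul1mx -mulmxA -trmx_mul mulmxV // trmx1 mulmx1.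
Qed.

Lemma ex_matrix_bform t (M := ex_matrix A B C t) :
  [/\ bform M (homogeneous A) (homogeneous A) = t ^+ 2,
      bform M (homogeneous B) (homogeneous B) = 1,
      bform M (homogeneous C) (homogeneous C) = (1 + t) ^+ 2
    & [/\ bform M (homogeneous A) (homogeneous B) = - t,
      bform M (homogeneous B) (homogeneous C) = 1 + t
    & bform M (homogeneous C) (homogeneous A) = t * (1 + t)]].
Proof.
have e i j := congr1 (fun N : 'M[R]_(2 + 1) => N i j) (ex_matrix_gram t).
have := (e 0 0, e 1 1, e 2 2, (e 0 1, e 1 2, e 2 0)).
rewrite !frame_bform !mxE /weight /= => -[[[-> ->] ->] [[-> ->] ->]].
by split; [ring|ring|ring|split; ring].
Qed.

(** The polar of the direction is the line at infinity: with [p + q + r = 0], the matrix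
    [inscribed t] sends [(p, q, r)] to [2 p q r (1, 1, 1)]. *)
Lemma ex_matrix_direction t u :
  bform (ex_matrix A B C t) (ideal (ex_direction A B C t)) u =
  - (2 * t * (1 + t)) * u 0 2.
Proof.
have [AA BB CC [AB BC CA]] := ex_matrix_bform t.
have sM := ex_matrix_sym t.
have [a [b [c ->]]] := frame_decomp u dF.
rewrite !(coordE, mxE) ideal_direction.
rewrite !(bformDl, bformDr, bformZl, bformZr) AA BB CC AB BC CA.
rewrite (bformC (homogeneous B) (homogeneous A)) // (bformC (homogeneous C) (homogeneous B)) //.
rewrite (bformC (homogeneous A) (homogeneous C)) //.
by rewrite AB BC CA; ring.
Qed.

Lemma det_ex_matrix t : t != 0 -> 1 + t != 0 -> \det (ex_matrix A B C t) != 0.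
Proof.
move=> t0 t1; rewrite /ex_matrix !det_mulmx det_tr !det_inv -/F.
rewrite !mulf_neq0 ?invr_eq0 //.
rewrite det3E !mxE /weight /=.
set x := (X in X != 0); have -> : x = - (4 * t ^+ 2 * (1 + t) ^+ 2) by rewrite /x; ring.
by rewrite oppr_eq0 !mulf_neq0 ?pnatr_eq0 ?expf_neq0.
Qed.

Lemma ex_direction_neq0 t : t != 0 -> 1 + t != 0 -> ex_direction A B C t != 0.
Proof.
move=> t0 t1; have := ex_matrix_direction t (homogeneous A).
rewrite coordE mulr1 => h; apply/eqP => e; move: h; rewrite e.
have -> : ideal (0 : 'rV[R]_2) = 0 *: homogeneous A.
  by apply: row3P; rewrite !(coordE, mxE) ?mul0r.
rewrite bformZl mul0r => /esym/eqP.
by rewrite oppr_eq0 !mulf_eq0 pnatr_eq0 (negbTE t0) (negbTE t1).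
Qed.

(** A nonzero kernel vector makes the upper left block singular: its determinant times the squared
    length of [p] is a combination of the two kernel equations. *)
Lemma parabola_of_isotropic M p : M^T = M -> \det M != 0 -> p != 0 ->
  (forall q, bform M (ideal p) (ideal q) = 0) -> parabola_matrix M.
Proof.
move=> sM dM p0 h; split => //.
have m10 : M 1 0 = M 0 1 by rewrite -{1}sM mxE.
have := h (\row_j (if j == 0 then 1 else 0)); have := h (\row_j (if j == 0 then 0 else 1)).
rewrite !bformE !coordE !mxE /= m10 => e1 e0.
have := sqr_coord_gt0 p0 => /lt0r_neq0 n0.
apply: (mulIf n0).
transitivity (M 0 1 ^+ 2 * (p 0 0 ^+ 2 + p 0 1 ^+ 2) +
  (M 0 0 * p 0 0 + M 0 1 * p 0 1) * (M 1 1 * p 0 0 - M 0 1 * p 0 1) * 0); last by ring.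
have {}e0 : M 0 0 * p 0 0 + M 0 1 * p 0 1 = 0 by rewrite -[RHS]e0; ring.
have {}e1 : M 0 1 * p 0 0 + M 1 1 * p 0 1 = 0 by rewrite -[RHS]e1; ring.
rewrite mulr0 addr0; apply/eqP; rewrite -subr_eq0; apply/eqP.
transitivity ((M 0 0 * p 0 0 + M 0 1 * p 0 1) * (M 1 1 * p 0 0 - M 0 1 * p 0 1)
 + (M 0 1 * p 0 0 + M 1 1 * p 0 1) * (M 0 0 * p 0 1 - M 0 1 * p 0 0)); first by ring.
by rewrite e0 e1; ring.
Qed.

Lemma ex_matrix_parabola t : t != 0 -> 1 + t != 0 -> parabola_matrix (ex_matrix A B C t).
Proof.
move=> t0 t1; apply: (@parabola_of_isotropic _ (ex_direction A B C t)).
- exact: ex_matrix_sym.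
- exact: det_ex_matrix.
- exact: ex_direction_neq0.
- by move=> q; rewrite ex_matrix_direction ideal2 mulr0.
Qed.

End Triangle.

(** Restricted to the tangent, the form has the contact point in its kernel, so its discriminant
    vanishes. *)
Lemma tangentP M U V : parabola_matrix M -> U <> V -> tangent (conic M) (line U V) ->
  bform M (homogeneous U) (homogeneous U) * bform M (homogeneous V) (homogeneous V) =
  bform M (homogeneous U) (homogeneous V) ^+ 2.
Proof.
move=> PM UV [T /(tangent_atP _ PM UV)[[s _ <-]]]; have [sM _ _] := PM.
rewrite homD idealZ idealB !(bformDl, bformZl, bformNl) (bformC (homogeneous V) (homogeneous U)) //.
set a := bform _ _ _; set b := bform _ _ _; set c := bform _ _ _ => e1 e2.
(* The general elimination multiplies by [s], so contact at [U] itself is separate. *)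
have [s0|s0] := eqVneq s 0.
  move: e1 e2; rewrite s0 => e1 e2.
  have -> : a = 0 by lra.
  have -> : b = 0 by lra.
  by ring.
apply: (mulfI s0).
transitivity (a * (b + s * (c - b)) - b * (a + s * (b - a)) + s * b ^+ 2); first by ring.
by rewrite e1 e2; ring.
Qed.

(** At [x U + y V] the form is [(u x - v y)^2]. Its double zero [(v : u)] is a finite point since
    [u + v != 0], and it is inside the segment exactly when [u] and [v] have the same sign. *)
Lemma touchP M U V (u v : R) : parabola_matrix M -> U <> V ->
  u != 0 -> v != 0 -> u + v != 0 ->
  bform M (homogeneous U) (homogeneous U) = u ^+ 2 ->
  bform M (homogeneous U) (homogeneous V) = - (u * v) ->
  bform M (homogeneous V) (homogeneous V) = v ^+ 2 ->
  tangent (conic M) (line U V) /\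
  (touches_side_inside U V (conic M) <-> 0 < u * v).
Proof.
move=> PM UV u0 v0 uv0 UU UV' VV; have [sM _ _] := PM.
pose T := U + (u / (u + v)) *: (V - U).
have tT : tangent_at (conic M) (line U V) T.
  apply/(tangent_atP _ PM UV); split; first by exists (u / (u + v)).
  - rewrite homD idealZ idealB !(bformDl, bformZl, bformNl) (bformC (homogeneous V)) //.
    by rewrite UU UV'; field.
  - by rewrite homD idealZ idealB !(bformDl, bformZl, bformNl) UV' VV; field.
split; first by exists T.
split.
  case=> _ [s /andP[s0 s1] <-] /(tangent_atP _ PM UV)[_ + _].
  rewrite homD idealZ idealB !(bformDl, bformZl, bformNl) (bformC (homogeneous V)) //.
  rewrite UU UV' => e.
  have e' : s * (u * v) = (1 - s) * u ^+ 2.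
    by apply/eqP; rewrite -subr_eq0; apply/eqP; rewrite -[RHS]oppr0 -e; ring.
  by rewrite -(pmulr_rgt0 _ s0) e' mulr_gt0 ?subr_gt0 // exprn_even_gt0.
move=> uv; exists T => //; exists (u / (u + v)) => //=.
(* [u + v] may be negative; the squared denominator makes numerator and denominator positive. *)
have -> : u / (u + v) = (u ^+ 2 + u * v) / (u + v) ^+ 2 by field.
have p2 : 0 < (u + v) ^+ 2 by rewrite exprn_even_gt0.
have pu : 0 < u ^+ 2 by rewrite exprn_even_gt0.
have pv : 0 < v ^+ 2 by rewrite exprn_even_gt0.
by rewrite divr_gt0 ?ltr_pdivrMr ?addr_gt0 // mul1r sqrrD; lra.
Qed.

End InscribedParabolas.

(** * Classification of the exparabolas, and the cubic equation of the axis condition *)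

Section AxisCubic.
Context {R : realType}.
Implicit Types (U V T X A B C p q : 'rV[R]_2) (u v w : 'rV[R]_(2 + 1)).
Implicit Types (M N K : 'M[R]_(2 + 1)).

Section Triangle.
Context (A B C : 'rV[R]_2).
Let F := frame (homogeneous A) (homogeneous B) (homogeneous C).
Context (dF : \det F != 0).

Lemma vertices_neq : [/\ B <> C, C <> A & A <> B].
Proof.
by split => e; move/eqP: dF; apply; rewrite /F e det_frameE; ring.
Qed.

(** On each side the two weights at its ends play the roles of [u] and [v] in [touchP]; their sum is
    minus the third weight, hence nonzero. *)
Lemma ex_matrix_exparabola t : t != 0 -> 1 + t != 0 ->
  let P := conic (ex_matrix A B C t) in
  [/\ exparabola A B C P,
      touches_side_inside B C P <-> t < - 1,
      touches_side_inside C A P <-> - 1 < t < 0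
    & touches_side_inside A B P <-> 0 < t].
Proof.
move=> t0 t1; have PM := ex_matrix_parabola dF t0 t1; have [sM _ _] := PM.
have [AA BB CC [AB BC CA]] := ex_matrix_bform dF t.
have [nBC nCA nAB] := vertices_neq.
have r0 : - 1 - t != 0 by rewrite -opprD oppr_eq0.
have [||||||tBC iBC] := @touchP _ _ B C 1 (- 1 - t) PM nBC; rewrite ?oner_eq0 //.
- by rewrite addrA subrr add0r oppr_eq0.
- by rewrite BB expr1n.
- by rewrite BC; ring.
- by rewrite CC; ring.
have [||||||tCA iCA] := @touchP _ _ C A (- 1 - t) t PM nCA; rewrite //.
- by rewrite subrK oppr_eq0 oner_eq0.
- by rewrite CC; ring.
- by rewrite CA; ring.
have [||||||tAB iAB] := @touchP _ _ A B t 1 PM nAB; rewrite ?oner_eq0 //.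
- by rewrite addrC.
- by rewrite AB mulr1.
- by rewrite BB expr1n.
split.
- by split=> //; exists (ex_matrix A B C t).
- by rewrite iBC mul1r subr_gt0.
- rewrite iCA; split; last by case/andP => h1 h2; nra.
  move=> h; apply/andP; split; nra.
- by rewrite iAB mulr1.
Qed.

(** The unknowns are the Gram entries at the vertices. Tangency gives the squares of [f], [g], [h],
    regularity fixes the sign of [f g h], and contact with the line at infinity gives the last
    relation [a = h + g]. *)
Lemma exparabola_ex_matrix P : exparabola A B C P ->
  exists t, [/\ t != 0, 1 + t != 0 & P = conic (ex_matrix A B C t)].
Proof.
case=> -[M PM ->] tBC tCA tAB; have [sM dM _] := PM.
have [nBC nCA nAB] := vertices_neq.
have := tangentP PM nBC tBC; have := tangentP PM nCA tCA; have := tangentP PM nAB tAB.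
have : \det (F *m M *m F^T) != 0 by rewrite !det_mulmx det_tr !mulf_neq0.
rewrite det3E !frame_bform /=.
rewrite (bformC (homogeneous B) (homogeneous A)) // (bformC (homogeneous C) (homogeneous B)) //.
rewrite (bformC (homogeneous A) (homogeneous C)) //.
have [w w0 ww] := parabola_isotropic PM.
have wA := isotropic_ker PM ww (ideal2 (B - A)).
have wB := isotropic_ker PM ww (ideal2 (C - A)).
have [x [y [z ew]]] := frame_decomp (ideal w) dF.
have xyz : x + y + z = 0.
  by have := ideal2 w; rewrite ew !(coordE, mxE) => e; rewrite -[RHS]e; ring.
have yz0 : (y != 0) || (z != 0).
  rewrite -negb_and; apply: contra w0 => /andP[/eqP y0 /eqP z0].
  have x0 : x = 0 by rewrite -[RHS]xyz y0 z0 !addr0.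
  move: ew; rewrite x0 y0 z0 !scale0r !addr0 => /rowP ew.
  by apply/eqP/row2P; [have := ew 0|have := ew 1]; rewrite !(coordE, mxE).
move: wA wB; rewrite ew !idealB !(bformDl, bformDr, bformZl, bformZr, bformNr).
rewrite (bformC (homogeneous B) (homogeneous A)) // (bformC (homogeneous C) (homogeneous B)) //.
rewrite (bformC (homogeneous A) (homogeneous C)) //.
have -> : x = - y - z by rewrite -[LHS]addr0 -[X in _ + X]oppr0 -xyz; ring.
have gram N : N^T = N ->
   bform N (homogeneous A) (homogeneous A) = bform M (homogeneous A) (homogeneous A) ->
   bform N (homogeneous B) (homogeneous B) = bform M (homogeneous B) (homogeneous B) ->
   bform N (homogeneous C) (homogeneous C) = bform M (homogeneous C) (homogeneous C) ->
   bform N (homogeneous A) (homogeneous B) = bform M (homogeneous A) (homogeneous B) ->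
   bform N (homogeneous B) (homogeneous C) = bform M (homogeneous B) (homogeneous C) ->
   bform N (homogeneous C) (homogeneous A) = bform M (homogeneous C) (homogeneous A) ->
   M = N.
  move=> sN eAA eBB eCC eAB eBC eCA; apply/eqP; rewrite -subr_eq0; apply/eqP.
  rewrite -[N]scale1r.
  apply: (bform_frame_eq0 dF); rewrite ?bform_subZ ?mul1r ?eAA ?eBB ?eCC ?eAB ?eBC ?subrr //.
    by rewrite linearB linearZ /= sM sN.
  by rewrite bformC // (bformC (homogeneous A)) // eCA subrr.
move: gram.
set a := bform M (homogeneous A) (homogeneous A).
set b := bform M (homogeneous B) (homogeneous B).
set c := bform M (homogeneous C) (homogeneous C).
set f := bform M (homogeneous B) (homogeneous C).
set g := bform M (homogeneous C) (homogeneous A).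
set h := bform M (homogeneous A) (homogeneous B).
move=> gram wA wB dG ab ca bc.
(* The Gram matrix of [B - A] and [C - A] has the nonzero kernel vector [(y, z)]. *)
have disc : (a + b - 2 * h) * (a + c - 2 * g) = (f - h - g + a) ^+ 2.
  set e11 := a + b - 2 * h; set e22 := a + c - 2 * g; set e12 := f - h - g + a.
  have {}wA : y * e11 + z * e12 = 0 by rewrite -[RHS]wA /e11 /e12; ring.
  have {}wB : y * e12 + z * e22 = 0 by rewrite -[RHS]wB /e12 /e22; ring.
  case/orP: yz0 => n0; apply: (mulfI n0).
    transitivity (y * e12 ^+ 2 + e22 * (y * e11 + z * e12) - e12 * (y * e12 + z * e22)); first by ring.
    by rewrite wA wB; ring.
  transitivity (z * e12 ^+ 2 + e11 * (y * e12 + z * e22) - e12 * (y * e11 + z * e12)); first by ring.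
  by rewrite wA wB; ring.
(* Given the tangency equations, the Gram determinant is [2 (f g h - a b c)]. *)
have {}dG : f * g * h - a * b * c != 0.
  apply: contra dG => /eqP e; apply/eqP.
  transitivity (2 * (f * g * h - a * b * c) - a * (f ^+ 2 - b * c) - b * (g ^+ 2 - c * a)
     - c * (h ^+ 2 - a * b)); first by ring.
  by rewrite e bc ca ab; ring.
(* The two products have equal squares and differ, so they are opposite. *)
have fgh : f * g * h = - (a * b * c).
  apply: (mulfI dG); apply/eqP; rewrite -subr_eq0; apply/eqP.
  transitivity (f ^+ 2 * g ^+ 2 * h ^+ 2 - (b * c) * (c * a) * (a * b)); first by ring.
  by rewrite bc ca ab; ring.
have abc0 : a * b * c != 0.
  by apply: contra dG => /eqP e; rewrite fgh e !oppr0 addr0.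
have [a0 b0 c0] : [/\ a != 0, b != 0 & c != 0].
  by move: abc0; rewrite !mulf_eq0 !negb_or -andbA => /and3P.
have g0 : g != 0 by rewrite -sqrf_eq0 -ca mulf_neq0.
have h0 : h != 0 by rewrite -sqrf_eq0 -ab mulf_neq0.
have f0 : f != 0 by rewrite -sqrf_eq0 -bc mulf_neq0.
have gh : g * h = - (a * f).
  apply: (mulfI f0); rewrite mulrA fgh; transitivity (- (a * (b * c))); first by ring.
  by rewrite bc; ring.
(* Multiplied by [a ^+ 2], the equation [disc] becomes a difference of squares that factors as
   [4 g h a (a - h - g)]. *)
have ahg : a = h + g.
  have n0 : 4 * g * h * a != 0 by rewrite !mulf_neq0 ?pnatr_eq0.
  apply/eqP; rewrite -subr_eq0; apply/eqP; apply: (mulfI n0).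
  transitivity ((a * a + h ^+ 2 - 2 * a * h) * (a * a + g ^+ 2 - 2 * a * g)
    - (- (g * h) - a * h - a * g + a * a) ^+ 2); first by ring.
  rewrite gh -ab -ca; transitivity (a ^+ 2 *
    ((a + b - 2 * h) * (a + c - 2 * g) - (f - h - g + a) ^+ 2)); first by ring.
  by rewrite disc; ring.
have t1E : 1 + - a / h = - g / h by rewrite ahg; field.
(* As [inscribed t] has entries 1 at [(B, B)] and [- t] at [(A, B)], the scale must be [b] and
   [t = - h / b], which is [- a / h] by [ab]. *)
exists (- a / h); rewrite t1E !mulf_neq0 ?invr_eq0 ?oppr_eq0 //; split => //.
have [AA BB CC [AB BC CA]] := ex_matrix_bform dF (- a / h).
rewrite (gram (b *: ex_matrix A B C (- a / h))) ?conic_scale //.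
- by rewrite linearZ /= ex_matrix_sym.
- rewrite bform_scale AA; transitivity (a * (a * b) / h ^+ 2); first by field.
  by rewrite ab; field.
- by rewrite bform_scale BB mulr1.
- rewrite bform_scale CC t1E; transitivity (g ^+ 2 * b / h ^+ 2); first by field.
  by rewrite -ca -ab; field; rewrite a0 b0.
- rewrite bform_scale AB; transitivity ((a * b) / h); first by field.
  by rewrite ab; field.
- rewrite bform_scale BC t1E; apply: (mulIf h0); apply: (mulIf g0).
  transitivity (- (b * g ^+ 2)); first by field.
  rewrite -ca; transitivity (f * g * h); last by ring.
  by rewrite fgh; ring.
- rewrite bform_scale CA t1E; transitivity (g * (a * b) / h ^+ 2); first by field.
  by rewrite ab; field.
Qed.

(* [(n0, n1, n2)] are, up to the factor [\det F], the barycentric coordinates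
   of the point at infinity orthogonal to the axis. *)
Lemma axis_cubic (X : 'rV[R]_2) (x0 x1 x2 t : R)
  (uu := dot (A - C) (A - C)) (uv := dot (A - C) (B - C)) (vv := dot (B - C) (B - C))
  (n0 := - (t * uv + vv)) (n1 := t * uu + uv) (n2 := t * (uv - uu) + (vv - uv)) :
  x0 + x1 + x2 = 1 -> X = x0 *: A + x1 *: B + x2 *: C ->
  t != 0 -> 1 + t != 0 ->
  axis_through (conic (ex_matrix A B C t)) X <->
  t * n0 * (t * x0 - x1 + (1 + t) * x2) + n1 * (- t * x0 + x1 + (1 + t) * x2)
  - (1 + t) * n2 * (- t * x0 - x1 - (1 + t) * x2) = 0.
Proof.
move=> hs hX t0 t1; have PM := ex_matrix_parabola dF t0 t1; have [sM _ _] := PM.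
have [AA BB CC [AB BC CA]] := ex_matrix_bform dF t.
have w0 := ex_direction_neq0 dF t0 t1.
have ww : bform (ex_matrix A B C t) (ideal (ex_direction A B C t)) (ideal (ex_direction A B C t)) = 0.
  by rewrite ex_matrix_direction // ideal2 mulr0.
rewrite (axis_throughP _ PM w0 ww).
have hX' : homogeneous X = x0 *: homogeneous A + x1 *: homogeneous B + x2 *: homogeneous C.
  by apply: row3P; rewrite hX !(coordE, mxE) //; rewrite !mulr1.
(* [n0], [n1], [n2] are the inner products of the direction [t (A - C) + (B - C)] with [C - B],
   [A - C] and [B - A]. *)
have dn : \det F *: ideal (perp (ex_direction A B C t)) =
   n0 *: homogeneous A + n1 *: homogeneous B + n2 *: homogeneous C.
  rewrite /F det_frameE /n0 /n1 /n2 /uu /uv /vv !dotE.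
  by apply: row3P; rewrite !(coordE, perp0, perp1, mxE); ring.
set Q := (X in _ <-> X = 0).
have -> : Q = \det F * bform (ex_matrix A B C t) (homogeneous X) (ideal (perp (ex_direction A B C t))).
  rewrite -bformZr dn hX' !(bformDl, bformDr, bformZl, bformZr).
  rewrite (bformC (homogeneous B) (homogeneous A)) // (bformC (homogeneous C) (homogeneous B)) //.
  rewrite (bformC (homogeneous A) (homogeneous C)) // AA BB CC AB BC CA /Q; ring.
split=> [->|/eqP]; first by rewrite mulr0.
by rewrite mulf_eq0 (negbTE dF) => /eqP.
Qed.

End Triangle.

(** The signs at minus infinity, -1, 0 and plus infinity alternate, which yields three roots by the
    intermediate value theorem; the degree excludes a fourth. *)
Lemma cubic_roots (c0 c1 c2 c3 : R) (f := fun t => c0 + c1 * t + c2 * t ^+ 2 + c3 * t ^+ 3) :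
  c3 < 0 -> f (- 1) < 0 -> 0 < f 0 ->
  exists r1 r2 r3, [/\ r1 < - 1, - 1 < r2 < 0, 0 < r3
    & forall t, f t = 0 <-> [\/ t = r1, t = r2 | t = r3]].
Proof.
move=> c3n fm1 f0.
pose p := Poly [:: c0; c1; c2; c3].
have pE t : p.[t] = f t by rewrite /p horner_Poly /= /f; ring.
have p3 : p`_3 = c3 by rewrite coef_Poly.
have ps : (size p <= 4)%N by apply: size_Poly.
have p0 : p != 0.
  by apply: contraTneq c3n => e; rewrite -p3 e coef0 ltxx.
have ivt a b : a <= b -> f a * f b < 0 -> exists2 r, a < r < b & f r = 0.
  rewrite -!pE => /polyrcf.poly_ivtoo h /h [r]; rewrite in_itv /= => rab /eqP.
  by rewrite pE => fr; exists r.
pose s := `|c0| + `|c1| + `|c2|.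
have n0 := normr_ge0 c0; have n1 := normr_ge0 c1; have n2 := normr_ge0 c2.
have s0 : 0 <= s by rewrite !addr_ge0.
(* A bound beyond which the cubic term dominates, chosen so that [s + c3 * T] is exactly [c3]. *)
pose T := 1 + s / - c3.
have T1 : 1 <= T by rewrite lerDl divr_ge0 // oppr_ge0 ltW.
have sT : s + c3 * T < 0.
  have -> : s + c3 * T = c3 by rewrite /T; field; exact: ltr0_neq0.
  exact: c3n.
have T2 : T <= T ^+ 2 by rewrite expr2 ler_peMl // (le_trans ler01).
have T2' : 0 < T ^+ 2 by apply: lt_le_trans T2; apply: lt_le_trans T1.
have low x : `|x| = T -> `|c0 + c1 * x + c2 * x ^+ 2| <= s * T ^+ 2.
  move=> xT; rewrite /s !mulrDl.
  apply: le_trans (ler_normD _ _) _; rewrite normrM normrX xT lerD //.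
  apply: le_trans (ler_normD _ _) _; rewrite normrM xT lerD //.
    by rewrite ler_peMr // (le_trans T1).
  by rewrite ler_wpM2l.
have fT : f T < 0.
  have := low T (ger0_norm (le_trans ler01 T1)); rewrite ler_norml => /andP[_ h].
  rewrite /f; have : (s + c3 * T) * T ^+ 2 < 0 by rewrite nmulr_rlt0.
  rewrite mulrDl -mulrA -exprS => h'; lra.
have fNT : 0 < f (- T).
  have := low (- T); rewrite normrN => /(_ (ger0_norm (le_trans ler01 T1))).
  rewrite ler_norml => /andP[h _].
  have : (s + c3 * T) * T ^+ 2 < 0 by rewrite nmulr_rlt0.
  rewrite mulrDl -mulrA -exprS /f [(- T) ^+ 3]exprNn => h'.
  have -> : (-1) ^+ 3 = -1 :> R by ring.
  lra.
have [||r1 /andP[_ r1n] f1] := ivt (- T) (- 1); rewrite ?lerN2 // ?pmulr_rlt0 //.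
have [||r2 r2n f2] := ivt (- 1) 0; rewrite ?lerN10 // ?nmulr_rlt0 //.
have [||r3 /andP[r3p _] f3] := ivt 0 T; rewrite ?(le_trans ler01) // ?pmulr_rlt0 //.
exists r1, r2, r3; split => // t; split; last by case=> ->.
move=> ft; case/andP: r2n => r2a r2b.
have [->|t1] := eqVneq t r1; first exact: Or31.
have [->|t2] := eqVneq t r2; first exact: Or32.
have [->|t3] := eqVneq t r3; first exact: Or33.
have r12 : r1 < r2 := lt_trans r1n r2a; have r23 : r2 < r3 := lt_trans r2b r3p.
(* Four distinct roots would require [4 < size p], as the size exceeds the degree by one. *)
have := @max_poly_roots _ p [:: t; r1; r2; r3] p0.
rewrite /= /root !pE ft f1 f2 f3 !eqxx !inE !negb_or t1 t2 t3 /=.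
rewrite !lt_eqF ?(lt_trans r12 r23) //=.
move=> /(_ isT isT) h.
by have := leq_trans h ps; rewrite ltnn.
Qed.

End AxisCubic.

(** * Counting the exparabolas *)

Lemma card_three (T : Type) (x y z : T) : x <> y -> y <> z -> x <> z ->
  [set x; y; z] #= `I_3.
Proof.
move=> xy yz xz.
have -> : [set x; y; z] = (fun i => nth x [:: x; y; z] i) @` `I_3.
  apply/seteqP; split => t.
    by case=> [[]|] ->; [exists 0%N|exists 1%N|exists 2%N].
  by case=> -[|[|[|//]]] _ /= <-; [left; left|left; right|right].
apply: inj_card_eq => -[|[|[|i]]] [|[|[|j]]]; rewrite !inE //= => _ _ e; exfalso; auto.
Qed.

Lemma dot_sub_gt0 (R : realType) (U V : 'rV[R]_2) : U <> V -> 0 < dot (U - V) (U - V).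
Proof.
move=> UV; rewrite dotE -!expr2; apply: sqr_coord_gt0.
by rewrite subr_eq0; apply/eqP.
Qed.

Theorem theorem2 (R : realType) (A B C X : 'rV[R]_2) (x0 x1 x2 : R)
  (hABC : nondegenerate_triangle A B C)
  (hsum : x0 + x1 + x2 = 1)
  (hX : X = x0 *: A + x1 *: B + x2 *: C)
  (h1 : 0 < (x0 + x1) * (x1 + x2))
  (h2 : 0 < (x0 + x2) * (x1 + x2))
  (h0 : 0 < (x0 + x1) * (x0 + x2)) :
  let E := exparabolas_with_axis_through A B C X in
  [/\ E #= `I_3,
      forall P, E P ->
        [\/ opposite_A A B C P, opposite_B A B C P | opposite_C A B C P],
      exists! P, E P /\ opposite_A A B C P,
      exists! P, E P /\ opposite_B A B C P
    & exists! P, E P /\ opposite_C A B C P].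
Proof.
have dF := nondegenerate_triangleP hABC.
have [nBC nCA nAB] := vertices_neq dF.
(* The three pairwise sums have the same sign, and they add up to 2. *)
have s01 : 0 < x0 + x1 by nra.
have s12 : 0 < x1 + x2 by nra.
have s02 : 0 < x0 + x2 by nra.
have cubic := axis_cubic dF hsum hX.
have aa := dot_sub_gt0 nBC.
have bb : 0 < dot (A - C) (A - C) by apply: dot_sub_gt0 => e; apply: nCA.
have cc : 0 < dot (A - C) (A - C) - 2 * dot (A - C) (B - C) + dot (B - C) (B - C).
  have := dot_sub_gt0 nAB; rewrite !dotE !mxE => h.
  by apply: lt_le_trans h _; rewrite le_eqVlt; apply/orP; left; apply/eqP; ring.
move: cubic aa bb cc; set uu := dot (A - C) (A - C); set uv := dot (A - C) (B - C).
set vv := dot (B - C) (B - C) => /= cubic aa bb cc.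
(* The coefficients in [t] of the cubic from [axis_cubic]. The values at -1 and at infinity are
   negative because [(t, 1, - 1 - t)] tends there to the opposites of the side directions
   [(1 : -1 : 0)] and [(-1 : 0 : 1)]. *)
pose c0 := vv * (x1 + x2).
pose c1 := vv * (x1 - x2) + uu * (x1 + x2) + uv * (x2 - x0)
  + (uv - uu) * (x1 + x2) + (vv - uv) * (x1 + x2) + (vv - uv) * (x0 + x2).
pose c2 := - uv * (x2 - x1) - vv * (x0 + x2) + uu * (x2 - x0)
  + (uv - uu) * (x1 + x2) + (uv - uu) * (x0 + x2) + (vv - uv) * (x0 + x2).
pose c3 := - (uu * (x0 + x2)).
have [|||r1 [r2 [r3 [r1n /andP[r2a r2b] r3p roots]]]] := @cubic_roots R c0 c1 c2 c3.
- by rewrite oppr_lt0 mulr_gt0.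
- have -> : c0 + c1 * -1 + c2 * (-1) ^+ 2 + c3 * (-1) ^+ 3 =
     - ((uu - 2 * uv + vv) * (x0 + x1)) by rewrite /c0 /c1 /c2 /c3; ring.
  by rewrite oppr_lt0 mulr_gt0.
- have -> : c0 + c1 * 0 + c2 * 0 ^+ 2 + c3 * 0 ^+ 3 = c0 by ring.
  by rewrite mulr_gt0.
pose P t := conic (ex_matrix A B C t).
have nz t : [\/ t = r1, t = r2 | t = r3] -> t != 0 /\ 1 + t != 0.
  case=> ->; split; try (by apply: lt0r_neq0; lra); apply: ltr0_neq0; lra.
have inE_ Q : exparabolas_with_axis_through A B C X Q <->
    [\/ Q = P r1, Q = P r2 | Q = P r3].
  split.
    case=> /(exparabola_ex_matrix dF)[t [t0 t1 ->]] /(cubic t t0 t1) e.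
    have : [\/ t = r1, t = r2 | t = r3].
      by apply/roots; rewrite -[RHS]e /c0 /c1 /c2 /c3; ring.
    by case=> ->; [apply: Or31|apply: Or32|apply: Or33].
  have E_ t : [\/ t = r1, t = r2 | t = r3] -> exparabolas_with_axis_through A B C X (P t).
    move=> rt; have [t0 t1] := nz _ rt.
    split; first by have [] := ex_matrix_exparabola dF t0 t1.
    by apply/(cubic t t0 t1); rewrite -[RHS](proj2 (roots t) rt) /c0 /c1 /c2 /c3; ring.
  by case=> ->; apply: E_; [apply: Or31|apply: Or32|apply: Or33].
have ex t : [\/ t = r1, t = r2 | t = r3] ->
    [/\ opposite_A A B C (P t) <-> t < - 1, opposite_B A B C (P t) <-> - 1 < t < 0
      & opposite_C A B C (P t) <-> 0 < t].
  move=> /nz[t0 t1]; have [eP tA tB tC] := ex_matrix_exparabola dF t0 t1.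
  by split; split; [move=> [_ /tA]|move/tA|move=> [_ /tB]|move/tB|move=> [_ /tC]|move/tC].
have [A1 B1 C1] := ex r1 (Or31 _ _ erefl).
have [A2 B2 C2] := ex r2 (Or32 _ _ erefl).
have [A3 B3 C3] := ex r3 (Or33 _ _ erefl).
have oA1 : opposite_A A B C (P r1) by apply/A1.
have oB2 : opposite_B A B C (P r2) by apply/B2; rewrite r2a.
have oC3 : opposite_C A B C (P r3) by apply/C3.
split.
- have -> : exparabolas_with_axis_through A B C X = [set P r1; P r2; P r3].
    apply/seteqP; split => Q.
      by move/inE_ => [] ->; [left; left|left; right|right].
    by case=> [[]|] ->; apply/inE_; [apply: Or31|apply: Or32|apply: Or33].
  (* The conics differ because their inner contact points lie on different sides: an equality would
     put a root into the range of another one. *)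
  apply: card_three => e.
  + by move: oB2; rewrite -e => /B1 h; lra.
  + by move: oC3; rewrite -e => /C2 h; lra.
  + by move: oC3; rewrite -e => /C1 h; lra.
- by move=> Q /inE_ [] ->; [apply: Or31|apply: Or32|apply: Or33].
- exists (P r1); split; first by split => //; apply/inE_; apply: Or31.
  by move=> Q [/inE_ [] -> //]; [move/A2|move/A3] => h; exfalso; lra.
- exists (P r2); split; first by split => //; apply/inE_; apply: Or32.
  by move=> Q [/inE_ [] -> //]; [move/B1|move/B3] => /andP[h h']; exfalso; lra.
- exists (P r3); split; first by split => //; apply/inE_; apply: Or33.
  by move=> Q [/inE_ [] -> //]; [move/C1|move/C2] => h; exfalso; lra.
Qed.
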